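(* Let $\mathcal F$ be a hereditary saturated formation such that every $\mathcal F$-critical group is soluble and has a normal Sylow $p$-subgroup $G_p\neq1$ for some prime $p$ (depending on the group). Let $G$ be a finite group. Then every $2$-maximal subgroup of $G$ is $\mathcal F$-subnormal in $G$ if and only if either $G\in\mathcal F$, or $G$ is an $\mathcal F$-critical group and $G^{\mathcal F}$ is a minimal normal subgroup of $G$.
   Context: All groups are finite. $\Phi(G)$ is the Frattini subgroup of $G$. For a class $\mathcal F$ of groups with $1\in\mathcal F$, $G^{\mathcal F}$ is the intersection of all normal subgroups $N$ of $G$ with $G/N\in\mathcal F$. A class $\mathcal F$ is a formation if either $\mathcal F=\emptyset$, or $1\in\mathcal F$ and every homomorphic image of $G/G^{\mathcal F}$ belongs to $\mathcal F$ for any group $G$. A formation $\mathcal F$ is saturated if $G/\Phi(G)\in\mathcal F$ implies $G\in\mathcal F$ for any group $G$, and hereditary if every subgroup of a group in $\mathcal F$ belongs to $\mathcal F$. A group $G$ is $\mathcal F$-critical if $G\notin\mathcal F$ but every proper subgroup of $G$ belongs to $\mathcal F$. A $2$-maximal subgroup of $G$ is a maximal subgroup of some maximal subgroup of $G$. For a non-empty formation $\mathcal F$, a subgroup $H$ of $G$ is $\mathcal F$-subnormal in $G$ if either $H=G$ or there is a chain $H=H_0<H_1<\dots<H_k=G$ such that, for $i=1,\dots,k$, $H_{i-1}$ is a maximal subgroup of $H_i$ and $H_i/(H_{i-1})_{H_i}\in\mathcal F$, where $(H_{i-1})_{H_i}$ is the core of $H_{i-1}$ in $H_i$ (the largest normal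 subgroup of $H_i$ contained in $H_{i-1}$). *)

(* Defs.v *)
From mathcomp Require Import all_boot all_fingroup all_solvable.
From mathcomp Require Import boolp.
Set Implicit Arguments.
Unset Strict Implicit.
Unset Printing Implicit Defensive.

Local Open Scope group_scope.

(* As usual, a class of groups is closed under isomorphism. *)
Record group_class := GroupClass {
  in_class : forall gT : finGroupType, {group gT} -> Prop;
  in_class_isog : forall (gT rT : finGroupType) (G : {group gT}) (H : {group rT}),
    G \isog H -> in_class G -> in_class H
}.

Definition has_trivial_groups (F : group_class) : Prop :=
  forall gT : finGroupType, in_class F (1%G : {group gT}).

(* The residual $G^{\mathcal F}$. If F contains the trivial groups, N = G is one
   of the subgroups being intersected, so that this is a subgroup of G; if no N
   qualifies, the empty intersection is the whole type gT. *)
Definition residual (F : group_class) (gT : finGroupType) (G : {group gT}) :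
    {set gT} :=
  \bigcap_(N : {group gT} | (N <| G) && `[< in_class F (G / N)%G >]) N.

Definition formation (F : group_class) : Prop :=
  (forall (gT : finGroupType) (G : {group gT}), ~ in_class F G) \/
  (has_trivial_groups F /\
   forall (gT rT : finGroupType) (G : {group gT})
     (f : {morphism G / residual F G >-> rT}),
     in_class F (f @* (G / residual F G))%G).

Definition saturated (F : group_class) : Prop :=
  forall (gT : finGroupType) (G : {group gT}),
    in_class F (G / 'Phi(G))%G -> in_class F G.

Definition hereditary (F : group_class) : Prop :=
  forall (gT : finGroupType) (G H : {group gT}),
    H \subset G -> in_class F G -> in_class F H.

Definition class_critical (F : group_class) (gT : finGroupType)
    (G : {group gT}) : Prop :=
  ~ in_class F G /\ (forall H : {group gT}, H \proper G -> in_class F H).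

Definition two_maximal (gT : finGroupType) (H G : {group gT}) : Prop :=
  exists M : {group gT}, maximal M G /\ maximal H M.

(* The case k = 0 is H = G. *)
Definition class_subnormal (F : group_class) (gT : finGroupType)
    (H G : {group gT}) : Prop :=
  exists (k : nat) (C : nat -> {group gT}),
    [/\ C 0 = H, C k = G &
        forall i : nat, i < k ->
          maximal (C i) (C i.+1) /\
          in_class F (C i.+1 / gcore (C i) (C i.+1))%G].

(* Main.v *)
(* If every 2-maximal subgroup is F-subnormal and M is maximal in G, then every
   maximal subgroup of M is F-subnormal in M, so it contains the residual of M;
   by saturation M is in F, hence G is in F or F-critical.  In the critical case
   let N be the residual of G, M a maximal subgroup not containing N, and
   P <> 1 the normal Sylow p-subgroup.  Then N <= P, the subgroup B = P :&: M is
   normal in G, and N <*> Q maps onto G / B for a complement Q of P; if it were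
   proper, G / B would be in F and N <= B <= M.  So N = P.  If N :&: M <> 1, a
   maximal subgroup H of M above a complement of N :&: M in M satisfies
   N * H = G, yet H being F-subnormal puts both N and H in a proper subgroup.
   Hence N :&: M = 1, and N is minimal normal.
   Conversely, if N is minimal normal then it is abelian, and for H maximal in M
   one has H <*> N <> G; any maximal subgroup of G above H <*> N gives a chain. *)
Require Import Defs.
From mathcomp Require Import all_boot all_fingroup all_solvable.
From mathcomp Require Import boolp.
Local Open Scope group_scope.

Lemma mulg_norm_maximal (gT : finGroupType) (G M K : {group gT}) :
  maximal M G -> K <| G -> ~~ (K \subset M) -> K * M = G.
Proof.
move=> maxM nKG nKM; have [sMG _] := andP (maxgroupp maxM).
have nKM' : M \subset 'N(K) by apply: subset_trans sMG (normal_norm nKG).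
rewrite -norm_joinEr //; apply/eqP; rewrite eqEproper join_subG.
rewrite (normal_sub nKG) sMG; apply/negP => prKM.
have [_ /(_ (K <*> M)%G prKM (joing_subr K M)) defM] := maxgroupP maxM.
by case/negP: nKM; rewrite -defM joing_subl.
Qed.

Lemma residual_group_set (F : group_class) (gT : finGroupType) (G : {group gT}) :
  group_set (residual F G).
Proof. exact: group_set_bigcap. Qed.

Canonical residual_group (F : group_class) (gT : finGroupType)
  (G : {group gT}) : {group gT} := Group (residual_group_set F gT G).

(** * Residuals and closure properties of a formation *)

Section Formations.

Variable F : group_class.
Hypotheses (F1 : has_trivial_groups F) (F_formation : formation F).

Lemma in_class_trivg (gT : finGroupType) (G : {group gT}) :
  G :=: 1 -> in_class F G.
Proof. by move=> G1; have -> : G = 1%G by apply: val_inj. Qed.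

Lemma residual_min (gT : finGroupType) (G N : {group gT}) :
  N <| G -> in_class F (G / N)%G -> residual F G \subset N.
Proof. by move=> nNG FGN; apply: bigcap_inf; rewrite nNG; apply/asboolP. Qed.

Lemma residual_sub_in_class (gT : finGroupType) (G K : {group gT}) :
  in_class F G -> residual F G \subset K.
Proof.
move=> FG; have sR1 : residual F G \subset 1%G.
  apply: residual_min; first exact: normal1.
  by apply: in_class_isog FG; apply: quotient1_isog.
exact: subset_trans sR1 (sub1G K).
Qed.

Lemma residual_normal (gT : finGroupType) (G : {group gT}) :
  residual F G <| G.
Proof.
apply/andP; split.
  by apply: residual_min => //; apply: in_class_trivg; apply: trivg_quotient.
by apply: norms_bigcap; apply/bigcapsP => N /andP[/andP[]].
Qed.

(** Converse of [residual_min]: [G / N] is a homomorphic image of [G / residual F G], so the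
    formation axiom applies. *)
Lemma in_class_quotient_residual (gT : finGroupType) (G N : {group gT}) :
  N <| G -> residual F G \subset N -> in_class F (G / N)%G.
Proof.
move=> nNG sRN; have [noF|[_ clF]] := F_formation.
  by case: (noF gT 1%G); apply: F1.
have /homgP[f defGN] :
    G / N \homg G / residual F G.
  by apply: homg_quotientS => //; apply: normal_norm => //; apply: residual_normal.
have -> : (G / N)%G = (f @* (G / residual F G))%G by apply: val_inj; rewrite /= defGN.
exact: clF.
Qed.

Lemma in_class_homg (gT rT : finGroupType) (G : {group gT}) (H : {group rT}) :
  H \homg G -> in_class F G -> in_class F H.
Proof.
move=> /homgP[f defH] FG.
have FGker : in_class F (G / 'ker f)%G.
  apply: in_class_quotient_residual; first exact: ker_normal.
  exact: residual_sub_in_class.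
by apply: in_class_isog FGker; rewrite /= -defH first_isog.
Qed.

Hypotheses (F_saturated : saturated F) (F_hereditary : hereditary F).

(** The form in which saturation is used: it is enough that every maximal subgroup contains the
    residual. *)
Lemma in_class_residual_Phi (gT : finGroupType) (G : {group gT}) :
  residual F G \subset 'Phi(G) -> in_class F G.
Proof.
move=> sRPhi; apply: F_saturated.
by apply: in_class_quotient_residual => //; apply: Phi_normal.
Qed.

(** By the second isomorphism theorem [U / (K :&: U)] is isomorphic to the subgroup [U / K] of
    [G / K], so heredity puts it in [F]. *)
Lemma residual_sub_class (gT : finGroupType) (G K U : {group gT}) :
  U \subset G -> K <| G -> in_class F (G / K)%G -> residual F U \subset K.
Proof.
move=> sUG nKG FGK; have nKU := subset_trans sUG (normal_norm nKG).
suffices sRKU : residual F U \subset (K :&: U)%G.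
  by apply: subset_trans sRKU (subsetIl K U).
apply: residual_min; first by rewrite /normal subsetIr normsI ?normG.
apply: in_class_isog (F_hereditary _ _ (U / K)%G (quotientS K sUG) FGK).
by rewrite isog_sym second_isog.
Qed.

(** * Chains of [F]-subnormal subgroups *)

Lemma class_subnormal_step (gT : finGroupType) (H M G : {group gT}) :
    class_subnormal F H M -> maximal M G -> residual F G \subset M ->
  class_subnormal F H G.
Proof.
move=> [k [C [C0 Ck Cstep]]] maxM sRM.
(* Indices above [k] take the value [G], so that index [k.+1] closes the chain. *)
exists k.+1, (fun i => if i <= k then C i else G); split=> [||i].
- by rewrite leq0n.
- by rewrite ltnn.
rewrite ltnS => le_ik; rewrite le_ik.
case: ltnP => [/Cstep //|le_ki].
have -> : i = k by apply/eqP; rewrite eqn_leq le_ik.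
rewrite Ck; split=> //; have sMG := proper_sub (maxgroupp maxM).
apply: in_class_quotient_residual; first exact: gcore_normal.
(* Being normal in [G], a residual inside [M] lies in the core of [M]. *)
by apply: gcore_max => //; apply: normal_norm; apply: residual_normal.
Qed.

(** Any chain of maximal subgroups will do: its members are in [F] by heredity, so their residuals
    are trivial. *)
Lemma in_class_subnormal (gT : finGroupType) (H G : {group gT}) :
  in_class F G -> H \subset G -> class_subnormal F H G.
Proof.
have [n] := ubnP #|G|; elim: n G => // n IHn G leGn FG sHG.
have [/val_inj ->|[M maxM sHM]] := maximal_exists sHG.
  by exists 0, (fun=> G); split.
have prMG := maxgroupp maxM.
apply: class_subnormal_step (maxM) _.
  apply: IHn => //; last by apply: F_hereditary FG; apply: proper_sub.
  by apply: leq_trans (proper_card prMG) _.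
exact: residual_sub_in_class.
Qed.

(** Descending from [G], let [A] be the first member of the chain not containing [U]. The member
    just above contains [U], and its quotient by the core of [A] is in [F], so the core contains the
    residual of [U]. *)
Lemma class_subnormal_residual (gT : finGroupType) (H G U : {group gT}) :
    class_subnormal F H G -> U \subset G -> ~~ (U \subset H) ->
  exists A : {group gT},
    [/\ H \subset A, ~~ (U \subset A) & residual F U \subset A].
Proof.
move=> [k [C [<- <- Cstep]]]; elim: k Cstep => [_ ->//|k IHk Cstep] sUC nUC0.
have [sUCk|nUCk] := boolP (U \subset C k).
  by apply: IHk => // i lt_ik; apply: Cstep; apply: ltnW.
have sC i : i <= k -> C 0 \subset C i.
  elim: i => // i IHi lt_ik; apply: subset_trans (IHi (ltnW lt_ik)) _.
  by case: (Cstep i (ltnW lt_ik)) => /maxgroupp/proper_sub.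
have [maxCk FCk] := Cstep k (leqnn _).
have sCk := proper_sub (maxgroupp maxCk).
exists (C k); split=> //; first exact: sC.
apply: subset_trans (gcore_sub _ (C k.+1)).
exact: residual_sub_class (gcore_normal sCk) FCk.
Qed.

(** * Proper subgroups and the structure of critical groups *)

Lemma two_maximal_subnormal_critical (gT : finGroupType) (G : {group gT}) :
    (forall H : {group gT}, two_maximal H G -> class_subnormal F H G) ->
  forall H : {group gT}, H \proper G -> in_class F H.
Proof.
move=> sn2 H prHG; have [/= defH|[M maxM sHM]] := maximal_exists (proper_sub prHG).
  by rewrite defH properxx in prHG.
apply: F_hereditary sHM _; apply: in_class_residual_Phi.
(* The Frattini subgroup is an intersection over [maximal_eq], so [K = M] also occurs. *)
apply/bigcapsP => K /predU1P[->|maxK]; first exact: normal_sub (residual_normal _ _).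
have [prKM maxKM] := maxgroupP maxK.
have snK : class_subnormal F K G by apply: sn2; exists M.
have [||A [sKA nMA sRA]] := class_subnormal_residual _ _ _ M snK.
- exact: proper_sub (maxgroupp maxM).
- by have [] := andP prKM.
(* [A :&: M] is proper in [M] and contains the maximal subgroup [K]. *)
have <- : A :&: M = K.
  apply: (maxKM (A :&: M)%G); last by rewrite subsetI sKA proper_sub.
  by rewrite properE subsetIr subsetI negb_and nMA.
by rewrite subsetI sRA normal_sub ?residual_normal.
Qed.

Lemma critical_residual_Sylow (gT : finGroupType) (G M P : {group gT}) (p : nat) :
    class_critical F G -> prime p -> p.-Sylow(G) P -> P <| G -> P :!=: 1 ->
    maximal M G -> ~~ (residual F G \subset M) ->
  residual F G = P.
Proof.
move=> [nFG FsubG] p_pr sylP nPG ntP maxM nRM.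
have nRG := residual_normal _ G.
have [sPG pP _] := and3P sylP; have [sMG _] := andP (maxgroupp maxM).
have /splitsP[Q /complP[tiPQ defG]] : [splits G, over P].
  by apply: SchurZassenhaus_split => //; apply: pHall_Hall sylP.
have sQG : Q \subset G by rewrite -defG mulG_subr.
(* [G / P] is an image of [Q], which is proper because [P] is nontrivial, hence in [F]. *)
have sRP : residual F G \subset P.
  apply: residual_min => //.
  have -> : (G / P)%G = (Q / P)%G by apply: val_inj; rewrite /= -defG quotientMidl.
  apply: in_class_homg (quotient_homg _) _.
    exact: subset_trans sQG (normal_norm nPG).
  apply: FsubG; rewrite properEneq sQG andbT; apply: contra ntP => /eqP defQ.
  by rewrite -subG1 -tiPQ defQ subsetI subxx.
have nPM : ~~ (P \subset M) by apply: contra nRM; apply: subset_trans.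
(* Normalizers grow in the p-group [P], so the normalizer of [P :&: M] in [G] strictly contains the
   maximal subgroup [M]. *)
have nBG : (P :&: M)%G <| G.
  have sMN : M \subset 'N_G(P :&: M).
    by rewrite subsetI sMG normsI ?normG // (subset_trans sMG) ?normal_norm.
  have prB : P :&: M \proper P by rewrite properE subsetIl subsetI subxx.
  have [_ prN] := andP (nilpotent_proper_norm (pgroup_nil pP) prB).
  rewrite /normal subIset ?sPG //=; apply/setIidPl/eqP.
  rewrite eqEproper subsetIl; apply/negP => prNG.
  have [_ /(_ 'N_G(P :&: M)%G prNG sMN) defM] := maxgroupP maxM.
  case/negP: prN; rewrite subsetI subsetIl /= -{2}defM.
  by rewrite /= subsetI subsetIr (subset_trans (subsetIl _ _)).
pose R := residual_group F gT G.
have defP : R * (P :&: M) = P.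
  by rewrite setIC group_modl // (mulg_norm_maximal _ _ _ R maxM nRG nRM); apply/setIidPr.
have nRQ : Q \subset 'N(R) by rewrite (subset_trans sQG) ?normal_norm.
have sRQG : R <*> Q \subset G by rewrite join_subG sQG normal_sub.
(* If [R <*> Q = G], Dedekind's law gives [P = R * (P :&: Q) = R]. Otherwise [R <*> Q] is in [F] and
   covers [G / (P :&: M)], which forces the residual into [M]. *)
have [defRQ|prRQ] := eqVproper sRQG.
  apply/eqP; rewrite eqEsubset sRP.
  have -> : P :=: P :&: R <*> Q by rewrite defRQ; symmetry; apply/setIidPl.
  by rewrite norm_joinEr // setIC -group_modl // setIC tiPQ mulg1 subxx.
case/negP: nRM; apply: subset_trans (subsetIr P M).
apply: residual_min => //.
have -> : (G / (P :&: M))%G = (R <*> Q / (P :&: M))%G.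
  have nBR : R \subset 'N(P :&: M).
    by rewrite (subset_trans (normal_sub nRG)) ?normal_norm.
  have defG' : (P :&: M) * (R * Q) = G by rewrite mulgA -(normC nBR) defP.
  by apply: val_inj; rewrite /= norm_joinEr // -[in LHS]defG' quotientMidl.
apply: in_class_homg (quotient_homg _) (FsubG _ prRQ).
exact: subset_trans (proper_sub prRQ) (normal_norm nBG).
Qed.

End Formations.

Theorem theoremC (F : group_class)
  (F_formation : formation F)
  (F_saturated : saturated F)
  (F_hereditary : hereditary F)
  (F_critical : forall (hT : finGroupType) (K : {group hT}), class_critical F K ->
     solvable K /\
     exists (p : nat) (P : {group hT}),
       [/\ prime p, p.-Sylow(K) P, P <| K & P :!=: 1])
  (gT : finGroupType) (G : {group gT}) :
  (forall H : {group gT}, two_maximal H G -> class_subnormal F H G) <->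
  (in_class F G \/
   [/\ class_critical F G, residual F G \subset G & minnormal (residual F G) G]).
Proof.
(* If [F] were empty, the trivial group would be critical, yet it has no nontrivial Sylow
   subgroup. *)
have F1 : has_trivial_groups F.
  have [noF|[]//] := F_formation; exfalso.
  have critical1 : class_critical F (1%G : {group gT}).
    by split=> [|H]; [apply: noF | rewrite properE sub1G andbF].
  have [_ [p [P [_ _ /normal_sub]]]] := F_critical _ _ critical1.
  by rewrite subG1 => ->.
have nRG := residual_normal _ F1 _ G; have sRG := normal_sub nRG.
split=> [sn2|[FG|[[nFG FsubG] _ minR]] H [M [maxM maxH]]]; first last.
- have [prHM maxHM] := maxgroupP maxH; have sHM := proper_sub prHM.
  have sMG := proper_sub (maxgroupp maxM); have sHG := subset_trans sHM sMG.
  have nRH := subset_trans sHG (normal_norm nRG).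
  have criticalG : class_critical F G by [].
  have [solG _] := F_critical _ _ criticalG.
  have prHR : H <*> residual F G \subset G by rewrite join_subG sHG.
  have [defHR|[L maxL]] := maximal_exists prHR; last first.
    rewrite join_subG => /andP[sHL sRL].
    apply: class_subnormal_step (maxL) sRL => //.
    by apply: in_class_subnormal => //; apply: FsubG (maxgroupp maxL).
  (* The case [H <*> residual F G = G] is refuted. The intersection of the residual with [M] is
     normalized by [M] and by the abelian residual, so it is trivial by minimality, and Dedekind's
     law then yields [H = M]. *)
  have [_ _ /abelem_abelian abR] := minnormal_solvable minR sRG solG.
  have [_ /negP nGM] := andP (maxgroupp maxM); case: (nGM).
  have [sRM|nRM] := boolP (residual F G \subset M).
    by rewrite -defHR join_subG sHM.
  have defG := mulg_norm_maximal _ _ _ (residual_group F _ G) maxM nRG nRM.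
  have [minR1 minRsub] := mingroupP minR.
  have nDG : G \subset 'N(residual F G :&: M).
    rewrite -defG mulG_subG (sub_abelian_norm abR) ?subsetIl //.
    by rewrite normsI ?normG ?(subset_trans sMG) ?normal_norm.
  have tiRM : residual F G :&: M = 1.
    apply/eqP/negPn/negP => ntD; case/negP: nRM.
    have -> : residual F G = (residual_group F _ G :&: M)%G.
      by rewrite minRsub ?subsetIl //= ntD.
    exact: subsetIr.
  have defM : H * (residual F G :&: M) = M.
    rewrite group_modl //; apply/setIidPr.
    by rewrite -norm_joinEl // defHR.
  by move: prHM; rewrite -defM tiRM mulg1 properxx.
- have sHG : H \subset G.
    exact: subset_trans (proper_sub (maxgroupp maxH)) (proper_sub (maxgroupp maxM)).
  exact: in_class_subnormal.
have [FG|nFG] := pselect (in_class F G); [by left | right].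
have criticalG : class_critical F G.
  by split=> //; apply: two_maximal_subnormal_critical.
have [_ [p [P [p_pr sylP nPG ntP]]]] := F_critical _ _ criticalG.
(* If no such [M] existed, the residual would lie in the Frattini subgroup. *)
have [M maxM nRM] : exists2 M : {group gT}, maximal M G & ~~ (residual F G \subset M).
  apply: contrapT => noM; apply: nFG; apply: in_class_residual_Phi => //.
  apply/bigcapsP => M /predU1P[-> //|maxM].
  by apply: contrapT => /negP nRM; case: noM; exists M.
have defR := critical_residual_Sylow _ F1 F_formation _ _ _ _ _ criticalG p_pr sylP nPG ntP maxM nRM.
have sMG := proper_sub (maxgroupp maxM).
have defG := mulg_norm_maximal _ _ _ (residual_group F _ G) maxM nRG nRM.
have tiPM : P :&: M = 1.
  have nDM : P :&: M <| M by rewrite /normal subsetIr normsI ?normG ?(subset_trans sMG) ?normal_norm.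
  (* [P :&: M] is a normal Sylow subgroup of [M], so Schur-Zassenhaus applies. *)
  have /splitsP[Q /complP[tiDQ defM]] : [splits M, over P :&: M].
    apply: SchurZassenhaus_split => //.
    by apply: pHall_Hall (setI_normal_Hall nPG sylP sMG).
  have sQM : Q \subset M by rewrite -defM mulG_subr.
  have [defQ|[H maxH sQH]] := maximal_exists sQM.
    by rewrite -tiDQ defQ -setIA setIid.
  have prHM := maxgroupp maxH; have sHG := subset_trans (proper_sub prHM) sMG.
  (* With [U] equal to [G], the proper subgroup [A] contains both [P] and [Q], hence [P * M = G]. *)
  have [|||A [sHA nGA sRA]] := class_subnormal_residual _ F_hereditary _ H G G (sn2 H _).
  - by exists M.
  - by [].
  - by apply: contra (proper_subn prHM); apply: subset_trans.
  case/negP: nGA; rewrite -defG mulG_subG sRA -defM mulG_subG (subset_trans sQH) // andbT.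
  by rewrite subIset // -defR sRA.
split=> //; rewrite defR; apply/mingroupP; split=> [|K /andP[ntK nKG] sKP].
  by rewrite ntP normal_norm.
have nKG' : K <| G by rewrite /normal nKG (subset_trans sKP) ?normal_sub.
(* Since [P :&: M] is trivial, [K * M = G], and Dedekind's law gives [P = K * (P :&: M) = K]. *)
have nKM : ~~ (K \subset M).
  by apply: contra ntK => sKM; rewrite -subG1 -tiPM subsetI sKP.
have defGK := mulg_norm_maximal _ _ _ K maxM nKG' nKM.
by rewrite -[K : {set _}]mulg1 -tiPM setIC group_modl // defGK; apply/setIidPr/normal_sub.
Qed.
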